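(* Let $X$ be an infinite Tychonoff space with $|X|=\mathfrak c$, where $\mathfrak c=2^{\aleph_0}$. (a) If $X$ is hereditarily separable, then $X$ is not a $\Delta$-space. (b) If $X$ is separable and hereditarily Lindel\''of, then $X$ is not a $\Delta$-space.
   Context: A topological space $X$ is a $\Delta$-space if for every decreasing sequence $\{D_n:n\in\omega\}$ of subsets of $X$ with empty intersection there is a decreasing sequence $\{V_n:n\in\omega\}$ of open subsets of $X$, also with empty intersection, such that $D_n\subseteq V_n$ for every $n\in\omega$. *)

(* Defs.v *)
From mathcomp Require Import all_boot all_order.
From mathcomp Require Import all_classical all_reals all_analysis.

Set Implicit Arguments.
Unset Strict Implicit.
Unset Printing Implicit Defensive.

Local Open Scope classical_set_scope.

(* The order on [set X] is inclusion, so [nonincreasing_seq] is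
   "decreasing" in the non-strict sense. *)
Definition delta_space (X : topologicalType) : Prop :=
  forall D : nat -> set X,
    nonincreasing_seq D -> \bigcap_n D n = set0 ->
    exists V : nat -> set X,
      [/\ nonincreasing_seq V,
          forall n, open (V n),
          \bigcap_n V n = set0
        & forall n, D n `<=` V n].

(* [uniform_separatorP] turns [completely_regular_space] into separation of
   points from closed sets by continuous [0, 1]-valued functions. *)
Definition tychonoff_space (X : topologicalType) : Prop :=
  accessible_space X /\ completely_regular_space X.

Definition separable_space (X : topologicalType) : Prop :=
  exists2 A : set X, countable A & dense A.

Definition lindelof_space (X : topologicalType) : Prop :=
  forall F : set (set X),
    F `<=` open -> \bigcup_(U in F) U = setT ->
    exists G : set (set X),
      [/\ G `<=` F, countable G & \bigcup_(U in G) U = setT].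

(* [set_type A] carries the subspace topology. *)
Definition hereditarily (P : topologicalType -> Prop) (X : topologicalType)
    : Prop :=
  forall A : set X, P (set_type A).

(* Main.v *)
Require Import Defs.
From mathcomp Require Import all_boot all_order.
From mathcomp Require Import all_classical all_reals all_analysis.

(** Such a space [X] has at most continuum many open sets, hence at most
continuum many sequences of open sets, so the points of [X] can be used to
enumerate all these sequences. A Cantor-style diagonal argument
([few_open_sets_not_delta]) then produces a decreasing sequence [D] with
empty intersection that no sequence of open sets with empty intersection
dominates: if [x] is the index of a sequence [V] with empty intersection and
[m] is the first rank at which [V] leaves [x] out, then [x] is put in [D m].

It remains to count the open sets; both counts rest on the fact that a family
of at most continuum many objects has at most continuum many countable
subfamilies ([countable_subsets_le_continuum]).
- If [X] is hereditarily separable, a closed set is the closure of one of its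
  countable subsets, so there are no more closed sets than countable subsets
  of [X] ([hereditarily_separable_open_le_continuum]).
- If [X] is regular with a countable dense set [A], the interiors of the
  closures of subsets of [A] form a base of size at most continuum. If [X] is
  moreover hereditarily Lindelof, every open set is a countable union of
  members of this base
  ([separable_hereditarily_lindelof_open_le_continuum]). *)

Local Open Scope classical_set_scope.
Local Open Scope card_scope.

(** * Families of size at most the continuum *)

Lemma powerset_le_continuum (T : Type) (A : set T) :
  countable A -> [set B | B `<=` A] #<= [set: set nat].
Proof.
move=> /pcard_injP[f finj].
apply/pcard_injP; exists (fun B => f @` B) => B C.
rewrite !inE /= => BA CA BC.
suff sub (P Q : set T) :
    P `<=` A -> Q `<=` A -> f @` P = f @` Q -> P `<=` Q.
  by apply/seteqP; split; apply: sub.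
move=> PA QA PQ x Px; have : (f @` Q) (f x) by rewrite -PQ; exists x.
by move=> [y Qy /finj <-]//; rewrite inE; [exact: QA|exact: PA].
Qed.

Lemma set_countType_le_continuum (T : countType) :
  [set: set T] #<= [set: set nat].
Proof.
apply: card_le_trans (powerset_le_continuum T setT (countableP _)).
exact: subset_card_le.
Qed.

Lemma sequences_le_continuum (T : Type) (A : set T) :
  A #<= [set: set nat] ->
  [set s : nat -> T | forall n, A (s n)] #<= [set: set nat].
Proof.
move=> /pcard_injP[f finj].
apply: card_le_trans (set_countType_le_continuum (nat * nat)%type).
apply/pcard_injP; exists (fun s => [set p | f (s p.1) p.2]) => s t.
rewrite !inE /= => As At /seteqP[st ts]; apply/funext => n.
by apply: finj; rewrite ?inE//; apply/seteqP; split=> m;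
  [exact: (st (n, m)) | exact: (ts (n, m))].
Qed.

(** A countable subfamily [G] is coded by a subset [C] of
[nat * option nat]: given [e] injective on [G], [C] holds [(e x, None)] to
signal that [e x] is the rank of a member of [G], and [(e x, Some m)] for each
[m] in the set of integers [f x] that identifies [x]. *)
Lemma countable_subsets_le_continuum (T : Type) (A : set T) :
  A #<= [set: set nat] ->
  [set G | G `<=` A /\ countable G] #<= [set: set nat].
Proof.
move=> /pcard_injP[f finj].
apply: card_le_trans (set_countType_le_continuum (nat * option nat)%type).
pose decode (C : set (nat * option nat)) := [set x | A x /\
  exists2 n, C (n, None) & f x = [set m | C (n, Some m)]].
apply: card_le_trans (card_image_le decode setT).
apply: subset_card_le => G [GA /countable_injP[e einj]].
exists [set p | exists2 x, G x & p.1 = e x /\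
  if p.2 is Some m then f x m else True] => //.
apply/seteqP; split=> [x [Ax [n [y Gy /= [ny _]] fx]]|x Gx].
  suff -> : x = y by [].
  apply: finj; rewrite ?inE//; first exact: GA.
  rewrite fx; apply/seteqP; split=> [m|m fym]; last by exists y.
  by case=> z Gz [] /[!ny] /einj -> //; rewrite inE.
split; first exact: GA.
exists (e x); first by exists x.
apply/seteqP; split=> [m fxm|m] /=; first by exists x.
by case=> z Gz [] /einj -> //; rewrite inE.
Qed.

(** * Diagonalization *)

(** The points [x] index all sequences [g x] of open sets. The first conjunct
in the definition of [D n] says that the first rank at which [g x] leaves [x]
out, if any, is at least [n]; the second one ensures that there is such a
rank, and so that the [D n] have empty intersection. *)
Lemma few_open_sets_not_delta (X : topologicalType) :
  [set U : set X | open U] #<= [set: set nat] ->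
  [set: set nat] #<= [set: X] -> ~ delta_space X.
Proof.
move=> /sequences_le_continuum opX natX.
have /pcard_surjP[g gsurj] := card_le_trans opX natX.
pose D n := [set x | (forall m, (m < n)%N -> g x m x) /\
                     exists m, ~ g x m x].
move=> /(_ D)[].
- move=> n p np; apply/subsetPset => x [gx exm]; split=> // m mn.
  exact/gx/(leq_trans mn).
- rewrite -subset0 => x Dx; have [_ [m []]] := Dx 0 I.
  by have [gx _] := Dx m.+1 I; exact: gx.
move=> V [_ Vop V0 DV]; have [x _ gx] := gsurj V Vop.
have exm : exists m, ~~ `[< V m x >].
  apply: contrapT => /forallNP Vx.
  suff : (\bigcap_n V n) x by rewrite V0.
  by move=> n _; apply/asboolP/negPn/negP/Vx.
case: (ex_minnP exm) => m /asboolP Vmx minm; apply/Vmx/DV.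
split; last by exists m; rewrite gx.
move=> k km; rewrite gx; apply: contrapT => Vkx.
by have := minm k (introN (asboolP _) Vkx); rewrite leqNgt km.
Qed.

(** * Counting open sets *)

Lemma hereditarily_separable_closed_closure {X : topologicalType}
    (C : set X) :
  hereditarily separable_space X -> closed C ->
  exists A : set X, countable A /\ closure A = C.
Proof.
move=> hsX cC; have [A cA dA] := hsX C; exists (set_val @` A); split.
  exact: sub_countable (card_image_le _ _) cA.
apply/seteqP; split.
  rewrite [X in _ `<=` X](iffLR (closure_id C) cC).
  by apply: closureS => _ [y _ <-]; exact: set_valP.
move=> x Cx B; rewrite nbhsE => -[U [oU Ux] UB].
have [||y [Uy Ay]] := dA (set_val @^-1` U).
- by exists (exist _ x (mem_set Cx)).
- by exists U.
- by exists (set_val y); split; [exists y|exact: UB].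
Qed.

Lemma hereditarily_separable_open_le_continuum (X : topologicalType) :
  hereditarily separable_space X -> [set: X] #<= [set: set nat] ->
  [set U : set X | open U] #<= [set: set nat].
Proof.
move=> hsX /countable_subsets_le_continuum; apply: card_le_trans.
apply: card_le_trans (card_image_le (fun G => ~` closure G) _).
apply: subset_card_le => U oU.
have [A [cA AU]] :=
  hereditarily_separable_closed_closure (~` U) hsX (open_closedC oU).
by exists A => //; rewrite AU setCK.
Qed.

(** [B] is the trace on [A] of an open neighborhood [V] of [x] whose closure
lies in [U]: by density [closure B] contains [V], whence [x] is interior to
it, and it is included in [closure V], hence in [U]. *)
Lemma regular_dense_base {X : topologicalType} (A U : set X) (x : X) :
  regular_space X -> dense A -> open U -> U x ->
  exists B, [/\ B `<=` A, (closure B)° x & (closure B)° `<=` U].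
Proof.
move=> rX dA oU Ux.
have [V nV VU] := rX x U (open_nbhs_nbhs (conj oU Ux)).
exists (V° `&` A); split; first exact: subIsetr.
- have VcA : V° `<=` closure (V° `&` A).
    move=> y Vy B; rewrite nbhsE => -[W [oW Wy] WB].
    have [||z [[Wz Vz] Az]] := dA (W `&` V°).
    + by exists y.
    + by apply: openI => //; exact: open_interior.
    + by exists z; split=> //; exact: WB.
  have := open_nbhs_nbhs (conj (open_interior V) nV).
  by apply: filterS.
apply: subset_trans (@interior_subset _ _) _; apply: subset_trans VU.
apply: closureS; apply: subset_trans (@interior_subset _ V).
exact: subIsetl.
Qed.

(** The Lindelof property of the subspace [U] applies to a cover of [U] by
open sets of [X] that are included in [U]: these can be recovered from their
preimages in [U], which spares a choice. *)
Lemma hereditarily_lindelof_open_bigcup {X : topologicalType}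
    (F : set (set X)) (U : set X) :
  hereditarily lindelof_space X -> F `<=` open ->
  (forall x, U x -> exists W, [/\ F W, W x & W `<=` U]) ->
  exists G, (G `<=` F /\ countable G) /\ \bigcup_(W in G) W = U.
Proof.
move=> hlX Fop Fbase.
pose pre (W : set X) : set (set_type U) := set_val @^-1` W.
have preK W : W `<=` U -> set_val @` pre W = W.
  move=> WU; apply/seteqP; split=> [_ [y Wy <-]//|x Wx].
  by exists (exist _ x (mem_set (WU _ Wx))).
have [||G [GF cG Gcov]] :=
    hlX U (pre @` [set W | F W /\ W `<=` U]).
- by move=> _ [W [FW _] <-]; exists W => //; exact: Fop.
- rewrite -subTset => x _.
  have [W [FW Wx WU]] := Fbase _ (set_valP x).
  by exists (pre W) => //; exists W.
exists ((fun B : set (set_type U) => set_val @` B) @` G); split.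
  split; last exact: sub_countable (card_image_le _ _) cG.
  by move=> _ [B /GF[W [FW WU] <-] <-]; rewrite preK.
apply/seteqP; split=> [x [_ [B GB <-]] [y _ <-]|x Ux].
  exact: set_valP.
have : (\bigcup_(B in G) B) (exist _ x (mem_set Ux)) by rewrite Gcov.
move=> [B GB Bx]; exists (set_val @` B); first by exists B.
by exists (exist _ x (mem_set Ux)).
Qed.

Lemma separable_hereditarily_lindelof_open_le_continuum
    (X : topologicalType) :
  regular_space X -> separable_space X -> hereditarily lindelof_space X ->
  [set U : set X | open U] #<= [set: set nat].
Proof.
move=> rX [A cA dA] hlX.
pose base := (fun B => (closure B)°) @` [set B : set X | B `<=` A].
have /countable_subsets_le_continuum : base #<= [set: set nat].
  apply: card_le_trans (card_image_le _ _) _ => /=.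
  exact: powerset_le_continuum.
apply: card_le_trans.
apply: card_le_trans (card_image_le (fun G => \bigcup_(W in G) W) _).
apply: subset_card_le => U oU.
have [||G [Gbase GU]] := hereditarily_lindelof_open_bigcup base U hlX.
- by move=> _ [B _ <-]; exact: open_interior.
- move=> x Ux; have [B [BA Bx BU]] := regular_dense_base A U x rX dA oU Ux.
  by exists (closure B)°; split=> //; exists B.
by exists G.
Qed.

(** A uniformity coarser than the topology that separates [x] from the
complement of a neighborhood [U] yields, since uniform spaces are regular, a
uniform neighborhood of [x] whose uniform closure lies in [U]; its closure in
[X] is smaller still. *)
Lemma completely_regular_space_regular (X : topologicalType) :
  completely_regular_space X -> regular_space X.
Proof.
move=> crX x U nU.
have [||uT [E [entE xE finer]]] := crX x (~` U°).
- by apply: open_closedC; exact: open_interior.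
- by move=> /(_ nU).
pose UT := Uniform.Pack uT.
have EU : xsection E x `<=` U.
  move=> y /xsectionP Exy; apply: interior_subset; apply: contrapT => nUy.
  by suff : set0 (x, y) by []; rewrite -xE.
have nE : nbhs (x : UT) (xsection E x).
  by rewrite -nbhs_entourageE; exists E.
have [V nV VE] := @uniform_regular UT x _ nE.
exists V; first exact: finer.
apply: subset_trans EU; apply: subset_trans VE => y Vy B nB.
exact/Vy/finer.
Qed.

Theorem proposition6p2 (X : topologicalType) :
  infinite_set [set: X] ->
  tychonoff_space X ->
  [set: X] #= [set: set nat] ->
  (hereditarily separable_space X -> ~ delta_space X) /\
  (separable_space X -> hereditarily lindelof_space X -> ~ delta_space X).
Proof.
move=> _ [_ /completely_regular_space_regular rX] /card_eqPle[Xc cX].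
split=> [hsX|sX hlX]; apply: few_open_sets_not_delta => //.
- exact: hereditarily_separable_open_le_continuum.
- exact: separable_hereditarily_lindelof_open_le_continuum.
Qed.
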